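(* Let $\nu=\sum_{i=1}^\infty \phi_i\delta_{x_i}$ be a probability measure supported in a compact subset of $[0,\infty)$ (with $\phi_i\ge 0$), let $X=\{x_i\}_{i=1}^\infty$, and let $X^2=\{s\cdot t: s,t\in X\}$. Then $$\nu^2=\sum_{z\in X^2}\Big(\sum_{(i,j):\,x_i x_j=z}\phi_i\phi_j\Big)\delta_z .$$
   Context: $\delta_z$ denotes the Dirac point mass at $z$. For a positive Borel measure $\nu$ with compact support in $[0,\infty)$, $\nu^2$ denotes the (unique) positive compactly supported Borel measure $\mu$ on $[0,\infty)$ with $\int t^n\,d\mu(t)=\left(\int t^n\,d\nu(t)\right)^2$ for all integers $n\ge0$; equivalently $\mu=(\nu\times\nu)\circ p^{-1}$ with $p(x,y)=xy$. The inner sum is over ordered pairs $(i,j)$. *)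

(* Defs.v *)
From HB Require Import structures.
From mathcomp Require Import all_boot all_order all_algebra.
From mathcomp Require Import all_classical all_reals all_analysis.

Set Implicit Arguments.
Unset Strict Implicit.
Unset Printing Implicit Defensive.

Import Order.TTheory GRing.Theory Num.Theory.
Import numFieldNormedType.Exports.

Local Open Scope classical_set_scope.
Local Open Scope ring_scope.
Local Open Scope ereal_scope.

(* A compactly supported Borel measure on [0, +oo[ is a Borel measure on the
   whole line that is concentrated on a compact subset of [0, +oo[. *)
Definition compactly_supported_ge0 (R : realType)
    (nu : {measure set (measurableTypeR R) -> \bar R}) : Prop :=
  exists K : set R, [/\ compact K, K `<=` `[0%R, +oo[ & nu (~` K) = 0].

Definition measure_moment (R : realType)
    (nu : {measure set (measurableTypeR R) -> \bar R}) (n : nat) : \bar R :=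
  \int[nu]_(t in `[0%R, +oo[) (t ^+ n)%:E.

(* [is_measure_square nu mu] says that mu is nu^2. Finiteness of mu is not
   required separately: for finite nu it is the moment identity at n = 0. *)
Definition is_measure_square (R : realType)
    (nu mu : {measure set (measurableTypeR R) -> \bar R}) : Prop :=
  compactly_supported_ge0 mu /\
  forall n : nat, measure_moment mu n = measure_moment nu n ^+ 2.

(* Main.v *)
(* The image of nu x nu under multiplication is the atomic measure with mass
   phi_i phi_j at x_i x_j; its moments are the squares of those of nu.
   Uniqueness needs no Weierstrass approximation since this measure is atomic:
   if |t - z| < c on the support, then (1 - ((t - z) / c)^2)^n lies in [0, 1]
   and decreases to the indicator of {z}, so by dominated convergence the
   moments determine the mass of every point. These point masses already
   exhaust the total mass, which is the moment of order 0. *)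
Require Import Defs.
From HB Require Import structures.
From mathcomp Require Import all_boot all_order all_algebra.
From mathcomp Require Import all_classical all_reals all_analysis.
From mathcomp Require Import measurable_realfun.

Set Implicit Arguments.
Unset Strict Implicit.
Unset Printing Implicit Defensive.

Import Order.TTheory GRing.Theory Num.Theory.
Import numFieldNormedType.Exports.
Local Open Scope classical_set_scope.
Local Open Scope ring_scope.
Local Open Scope ereal_scope.

Local Notation borel_measure R := {measure set (measurableTypeR R) -> \bar R}.

(** * Moments as integrals over a bounded interval *)

Lemma compactly_supported_ge0_itv (R : realType) (mu : borel_measure R) :
  compactly_supported_ge0 mu ->
  exists C0 : R, forall C : R, (C0 <= C)%R -> mu (~` `[0%R, C]) = 0.
Proof.
move=> [K [cK K0 muK]]; have [M [_ KM]] := compact_bounded cK.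
(* [KM] bounds [K] only by reals strictly above [M]; the [+ 1] supplies the strictness. *)
exists (`|M| + 1)%R => C MC.
apply: (@subset_measure0 _ _ _ mu _ (~` K)) => //.
- by apply: measurableC; exact: measurable_itv.
- by apply: measurableC; exact: compact_measurable.
- move=> t /= tC Kt; apply: tC; have /= := K0 _ Kt.
  rewrite !in_itv/= andbT => -> /=.
  apply: le_trans MC; apply: le_trans (ler_norm _) _.
  by apply: KM => //; rewrite ltr_pwDr// ler_norm.
Qed.

Lemma measure_moment_itv (R : realType) (mu : borel_measure R) (C : R)
    (n : nat) : mu (~` `[0%R, C]) = 0 ->
  measure_moment mu n = \int[mu]_(t in `[0%R, C]) (t ^+ n)%:E.
Proof.
move=> muC.
rewrite /measure_moment (@ge0_negligible_integral _ _ _ mu _ (~` `[0%R, C]))//.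
- congr integral; rewrite setDE setCK; apply/seteqP; split=> t /=.
    by case.
  by move=> tC; split => //; move: tC; rewrite !in_itv/= andbT => /andP[].
- by apply: measurableC; exact: measurable_itv.
- by apply/measurable_EFinP; exact: exprn_measurable.
- by move=> t /=; rewrite in_itv/= andbT lee_fin => t0; rewrite exprn_ge0.
Qed.

Lemma measure_moment0 (R : realType) (mu : borel_measure R) :
  compactly_supported_ge0 mu -> measure_moment mu 0 = mu setT.
Proof.
move=> /compactly_supported_ge0_itv[C /(_ _ (lexx C)) muC].
rewrite (measure_moment_itv _ muC).
under eq_integral do rewrite expr0.
rewrite integral_cst ?mul1e; last exact: measurable_itv.
have mC : measurable (`[0%R, C] : set (measurableTypeR R)).
  exact: measurable_itv.
have -> : mu setT = mu `[0%R, C]%classic + mu (~` `[0%R, C]).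
  by rewrite -measureU ?setUv ?setICr//; exact: measurableC.
by rewrite muC adde0.
Qed.

Lemma integrable_horner (R : realType) (mu : borel_measure R) (C : R)
    (p : {poly R}) : mu `[0%R, C]%classic < +oo ->
  mu.-integrable `[0%R, C]%classic (EFin \o horner p).
Proof.
move=> muC; apply: measurable_bounded_integrable => //.
- apply measurable_funTS; apply: continuous_measurable_fun.
  exact: continuous_horner.
- have /compact_bounded[M [Mreal pM]] : compact (horner p @` `[0%R, C]).
    apply: continuous_compact (@segment_compact _ _ _).
    exact/continuous_subspaceT/continuous_horner.
  by exists M; split => // N MN t tC /=; apply: pM => //; exists t.
Qed.

(** By linearity of the integral. This is what carries equality of moments over to integrals of
    arbitrary polynomials, in particular of powers of [bump z c]. *)
Lemma integral_horner_moments (R : realType) (mu : borel_measure R) (C : R)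
    (p : {poly R}) : mu (~` `[0%R, C]) = 0 -> mu `[0%R, C]%classic < +oo ->
  \int[mu]_(t in `[0%R, C]) (p.[t])%:E =
  \sum_(i < size p) (p`_i)%:E * measure_moment mu i.
Proof.
move=> muC muCoo; have mC : measurable (`[0%R, C] : set (measurableTypeR R)).
  exact: measurable_itv.
have iX i : mu.-integrable `[0%R, C]%classic (fun t => (t ^+ i)%:E).
  have := integrable_horner ('X^i) muCoo.
  by apply: eq_integrable => // t _ /=; rewrite hornerXn.
under eq_integral do rewrite horner_coef -sumEFin.
rewrite integral_sum//.
  apply: eq_bigr => i _; rewrite (measure_moment_itv _ muC) -integralZl//.
move=> i; have := integrableZl mC p`_i (iX i).
by apply: eq_integrable.
Qed.

(** * Polynomials peaking at a point, and recovery of point masses from moments *)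

Definition bump (R : realType) (z c : R) : {poly R} :=
  (1 - (c^-1 *: ('X - z%:P)) ^+ 2)%R.

Lemma horner_bump (R : realType) (z c t : R) :
  (bump z c).[t] = (1 - ((t - z) / c) ^+ 2)%R.
Proof. by rewrite /bump !hornerE mulrC. Qed.

Lemma bump_itv01 (R : realType) (z c t : R) : (`|t - z| < c)%R ->
  (0 < (bump z c).[t] <= 1)%R.
Proof.
move=> tzc; have c0 : (0 < c)%R := le_lt_trans (normr_ge0 _) tzc.
rewrite horner_bump subr_gt0 gerBl sqr_ge0 andbT -real_normK ?num_real//.
by rewrite expr_lt1 // normrM normfV (gtr0_norm c0) ltr_pdivrMr// mul1r.
Qed.

Lemma cvg_bump (R : realType) (z c t : R) : (`|t - z| < c)%R ->
  (fun n => ((bump z c ^+ n).[t])%:E) @ \oo --> (\1_[set z] t)%:E.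
Proof.
move=> tzc; apply: cvg_EFin; first exact: nearW.
have [b0 b1] := andP (bump_itv01 tzc).
rewrite indicE; have [->|tz] := eqVneq t z.
  rewrite mem_set//=; apply: (@cvg_trans _ (nbhs (1%R : R))); last by [].
  apply: cvg_near_cst; apply: nearW => n.
  by rewrite /= horner_exp horner_bump subrr mul0r expr0n subr0 expr1n.
rewrite memNset/=; last exact/eqP.
have := @cvg_expr R (bump z c).[t].
rewrite gtr0_norm// lt_neqAle b1 andbT.
have -> : (bump z c).[t] != 1%R.
  rewrite horner_bump -subr_eq0 addrAC subrr add0r oppr_eq0 expf_eq0/=.
  rewrite mulf_neq0// ?subr_eq0// invr_eq0 gt_eqF//.
  exact: le_lt_trans (normr_ge0 _) tzc.
move=> /(_ isT); under [X in _ -> X @ _ --> _]eq_fun do rewrite /= horner_exp.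
by [].
Qed.

Lemma cvg_integral_bump (R : realType) (mu : borel_measure R) (C z c : R) :
  mu (~` `[0%R, C]) = 0 -> mu `[0%R, C]%classic < +oo ->
  (forall t, t \in `[0%R, C] -> (`|t - z| < c)%R) ->
  (fun n => \int[mu]_(t in `[0%R, C]) ((bump z c ^+ n).[t])%:E) @ \oo -->
    mu [set z].
Proof.
move=> muC muCoo zc.
have mC : measurable (`[0%R, C] : set (measurableTypeR R)).
  exact: measurable_itv.
have mz : measurable ([set z] : set (measurableTypeR R)).
  exact: measurable_set1.
have -> : mu [set z] = \int[mu]_(t in `[0%R, C]) (\1_[set z] t)%:E.
  rewrite integral_indic//; have [zC|zC] := pselect (`[0%R, C]%classic z).
    by congr (mu _); apply/esym/setIidPl => _ ->.
  (* If [z] lies outside [[0, C]], both sides vanish, the left one because [[set z]] sits in the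
     null complement of the interval. *)
  rewrite (_ : [set z] `&` _ = set0) ?measure0; last first.
    by apply/seteqP; split => // t [-> /zC].
  apply: (@subset_measure0 _ _ _ mu _ (~` `[0%R, C])) => //.
    exact: measurableC.
  by move=> _ ->.
have [|||||_ _] := @dominated_convergence _ _ _ mu `[0%R, C]%classic mC
    (fun n t => ((bump z c ^+ n).[t])%:E) (fun t => (\1_[set z] t)%:E) (cst 1).
- move=> n; exact: measurable_int (integrable_horner _ muCoo).
- by apply/measurable_EFinP; apply: measurable_indic.
- by apply: aeW => t /zc; exact: cvg_bump.
- have := integrable_horner 1%R muCoo.
  by apply: eq_integrable => // t _ /=; rewrite hornerC.
- apply: aeW => t n /zc/bump_itv01/andP[b0 b1].
  by rewrite /= lee_fin horner_exp ger0_norm ?exprn_ge0 ?exprn_ile1// ltW.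
by [].
Qed.

(** Each power of one common bump has the same integral under both measures, and the limits of these
    integrals are the two masses at [z]. *)
Lemma moments_point_mass (R : realType) (mu1 mu2 : borel_measure R) (z : R) :
  compactly_supported_ge0 mu1 -> compactly_supported_ge0 mu2 ->
  mu1 setT < +oo ->
  (forall n, measure_moment mu1 n = measure_moment mu2 n) ->
  mu1 [set z] = mu2 [set z].
Proof.
move=> s1 s2 fin1 m12.
have fin2 : mu2 setT < +oo by rewrite -measure_moment0// -m12 measure_moment0.
have [C1 s1C] := compactly_supported_ge0_itv s1.
have [C2 s2C] := compactly_supported_ge0_itv s2.
(* Each measure is carried by every sufficiently long interval, so a single one serves both. *)
pose C := Num.max C1 C2.
have mC : measurable (`[0%R, C] : set (measurableTypeR R)).
  exact: measurable_itv.
have {}s1C : mu1 (~` `[0%R, C]) = 0 by apply: s1C; rewrite le_max lexx.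
have {}s2C : mu2 (~` `[0%R, C]) = 0 by apply: s2C; rewrite le_max lexx orbT.
have fin (mu : borel_measure R) : mu setT < +oo -> mu `[0%R, C]%classic < +oo.
  by apply: le_lt_trans; rewrite le_measure// inE.
(* The width comes from [|t - z| <= |t| + |z| <= C + |z|], made strict by the [+ 1]. *)
have zc t : t \in `[0%R, C] -> (`|t - z| < C + `|z| + 1)%R.
  rewrite in_itv/= => /andP[t0 tC]; rewrite (le_lt_trans (ler_normB _ _))//.
  by rewrite ger0_norm// ltr_pwDr// lerD2r.
have eqI (p : {poly R}) :
    \int[mu1]_(t in `[0%R, C]) (p.[t])%:E =
    \int[mu2]_(t in `[0%R, C]) (p.[t])%:E.
  rewrite !integral_horner_moments ?fin//.
  by apply: eq_bigr => i _; rewrite m12.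
have := cvg_integral_bump s1C (fin _ fin1) zc.
under eq_fun do rewrite eqI.
by move/cvg_unique; apply => //; exact: cvg_integral_bump s2C (fin _ fin2) zc.
Qed.

(** * From point masses to equality of measures *)

Lemma eq_measure_countable (R : realType) (mu1 mu2 : borel_measure R)
    (B : set (measurableTypeR R)) :
  countable B -> (forall z, mu1 [set z] = mu2 [set z]) -> mu1 B = mu2 B.
Proof.
move=> /countable_injP[f injf] m12.
(* The fibers of the injection [f] cut [B] into disjoint pieces with at most one point each, so
   countable additivity reduces the claim to points. *)
pose F n : set (measurableTypeR R) := B `&` f @^-1` [set n].
have F1 n : F n = set0 \/ exists z, F n = [set z].
  have [->|/set0P[z Fz]] := eqVneq (F n) set0; [by left|right].
  have [Bz fz] := Fz.
  exists z; apply/seteqP; split => [t [Bt ft]|_ ->//].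
  by apply: injf; rewrite ?inE// ft.
have mF n : measurable (F n).
  by case: (F1 n) => [->|[z ->]] //; exact: measurable_set1.
have BF : B = \bigcup_n F n.
  by apply/seteqP; split => [t Bt|t [n _ []]//]; exists (f t).
have tF : trivIset setT F by move=> i j _ _ [t [[_ <-] [_ <-]]].
rewrite BF !measure_bigcup//; apply: eq_eseriesr => n _.
by case: (F1 n) => [->|[z ->]]; rewrite ?measure0.
Qed.

(* Equality of the total masses forces [mu1], a priori only known to dominate
   the purely atomic [mu2], to have no mass off the atoms of [mu2]. *)
Lemma eq_measure_atomic (R : realType) (mu1 mu2 : borel_measure R)
    (X A : set (measurableTypeR R)) :
  countable X -> mu2 (~` X) = 0 -> mu1 setT < +oo -> mu1 setT = mu2 setT ->
  (forall z, mu1 [set z] = mu2 [set z]) -> measurable A -> mu1 A = mu2 A.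
Proof.
move=> cX muX fin1 m12T m12 mA.
have mX : measurable X.
  by apply: countable_measurable => //; exact: measurable_set1.
have m1X : mu1 X = mu2 X by exact: eq_measure_countable.
have m2T : mu2 setT = mu2 X.
  by rewrite (measureDI mu2 measurableT mX) setTI setTD [X in X + _]muX add0e.
have muX1 : mu1 (~` X) = 0.
  rewrite -setTD measureD// setTI [X in X - _]m12T m2T [X in _ - X]m1X subee//.
  by rewrite -m2T -m12T ge0_fin_numE.
have AX (mu : borel_measure R) : mu (~` X) = 0 -> mu A = mu (A `&` X).
  move=> mu0; rewrite (measureDI mu mA mX) [X in X + _](_ : _ = 0) ?add0e//.
  apply: (@subset_measure0 _ _ _ mu _ (~` X)) => //.
  - exact: measurableD.
  - exact: measurableC.
rewrite !AX//; apply: eq_measure_countable => //.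
by apply: sub_countable cX; apply: subset_card_le.
Qed.

(** * The atomic measure on products *)

Section atomic_square.
Variables (R : realType) (phi x : nat -> R).
Hypothesis phi_ge0 : forall i, (0 <= phi i)%R.

(** The image under multiplication of the product with itself of the measure with mass [phi i] at
    [x i]. An iterated series of scaled Dirac masses lets integrals expand term by term into a
    double series. *)
Definition atomic_square : borel_measure R :=
  mseries (fun i => mseries (fun j =>
    mscale (NngNum (mulr_ge0 (phi_ge0 i) (phi_ge0 j)))
      (@dirac _ (measurableTypeR R) (x i * x j)%R R)) 0) 0.

Lemma atomic_squareE (A : set (measurableTypeR R)) :
  atomic_square A = \esum_(ij in [set: nat * nat])
    ((phi ij.1 * phi ij.2)%:E * \d_(x ij.1 * x ij.2)%R A).
Proof.
have w0 i j : 0 <= (phi i * phi j)%:E * \d_(x i * x j)%R A.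
  by rewrite mule_ge0// lee_fin mulr_ge0.
transitivity (\sum_(i <oo) \sum_(j <oo)
    ((phi i * phi j)%:E * \d_(x i * x j)%R A)); first by [].
rewrite nneseries_esumT; last by move=> i; exact: nneseries_ge0.
rewrite (eq_esum (fun i _ => nneseries_esumT (w0 i))) esum_esum//.
by congr esum; apply/seteqP; split.
Qed.

(** Index pairs are grouped by the value of their product; all terms are nonnegative, so the
    regrouping is valid without any summability. *)
Lemma atomic_square_fibers (A : set (measurableTypeR R)) :
  atomic_square A =
  \esum_(z in [set (s * t)%R | s in range x & t in range x])
    ((\esum_(ij in [set ij : nat * nat | (x ij.1 * x ij.2)%R = z])
        (phi ij.1 * phi ij.2)%:E) * \d_z A).
Proof.
have w0 ij : 0 <= (phi ij.1 * phi ij.2)%:E.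
  by rewrite lee_fin mulr_ge0.
pose F z := [set ij : nat * nat | (x ij.1 * x ij.2)%R = z].
set X2 := [set (s * t)%R | s in range x & t in range x].
transitivity (\esum_(z in X2) \esum_(ij in F z)
    ((phi ij.1 * phi ij.2)%:E * \d_(x ij.1 * x ij.2)%R A)).
  rewrite esum_esum; last by move=> *; rewrite mule_ge0// w0.
  rewrite atomic_squareE; symmetry.
  (* Tagging each pair with its product is a bijection from all pairs onto the disjoint union of the
     fibers [F z] over [z] in [X2]. *)
  apply: (@reindex_esum R _ _ setT _
    (fun ij : nat * nat => ((x ij.1 * x ij.2)%R, ij))).
  split=> [[i j] _ /=|[i j] [k l] _ _ []//|[z [i j]] /= [_ <-]].
  - by split => //; exists (x i); [exists i|exists (x j); [exists j|]].
  - by move=> _ -> ->.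
  - by exists (i, j).
apply: eq_esum => z _; rewrite diracE.
transitivity (\esum_(ij in F z) ((phi ij.1 * phi ij.2)%:E * \d_z A)).
  by apply: eq_esum => ij ->.
(* The common factor is 1 or 0, so it leaves the sum even when the sum is infinite, as
   [+oo * 0 = 0]. *)
rewrite diracE; case: (z \in A).
  by under eq_esum do rewrite mule1; rewrite mule1.
by rewrite mule0 esum1// => ij _; rewrite mule0.
Qed.

End atomic_square.

Lemma countable_range2 (R : realType) (x : nat -> R) :
  countable [set (s * t)%R | s in range x & t in range x].
Proof.
rewrite [X in countable X](_ : _ =
    (fun ij : nat * nat => x ij.1 * x ij.2)%R @` setT).
  exact: sub_countable (card_image_le _ _) (countableP _).
apply/seteqP; split => [_ [_ [i _ <-] [_ [j _ <-] <-]]|_ [[i j] _ <-]].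
  by exists (i, j).
by exists (x i); [exists i|exists (x j); [exists j|]].
Qed.

Lemma atoms_in_support (R : realType) (phi x : nat -> R)
    (S : set (measurableTypeR R)) :
  (forall i : nat, (0 <= phi i)%R) ->
  \sum_(i <oo) (phi i)%:E * \d_(x i) (~` S) = 0 ->
  forall i, phi i != 0%R -> S (x i).
Proof.
move=> phi0 nuS i phii; apply: contrapT => NSi.
have t0 k : 0 <= (phi k)%:E * \d_(x k) (~` S) by rewrite mule_ge0 ?lee_fin.
have : (phi i)%:E * \d_(x i) (~` S) <= 0.
  rewrite -nuS nneseries_esumT//; apply: esum_ge.
  by exists [set i]; [split|rewrite fsbig_set1].
by rewrite diracE mem_set// mule1 lee_fin leNgt lt_neqAle eq_sym phii phi0.
Qed.

(** * Support and moments of the atomic square *)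

Section atomic_square_moments.
Variables (R : realType) (phi x : nat -> R) (C : R).
Hypothesis phi_ge0 : forall i, (0 <= phi i)%R.
Hypothesis xC : forall i, phi i != 0%R -> (0 <= x i <= C)%R.

Let a n i : R := (phi i * x i ^+ n)%R.

(** A negative [x i] can only carry weight 0, and then the product vanishes. *)
Let a_ge0 n i : (0 <= a n i)%R.
Proof.
rewrite /a; have [->|/xC/andP[x0 _]] := eqVneq (phi i) 0%R.
  by rewrite mul0r.
by rewrite mulr_ge0// exprn_ge0.
Qed.

Lemma compactly_supported_atomic_square :
  compactly_supported_ge0 (atomic_square x phi_ge0).
Proof.
exists `[0%R, (C ^+ 2)%R]%classic; split; first exact: segment_compact.
  by move=> t /=; rewrite !in_itv/= andbT => /andP[].
rewrite atomic_squareE; apply: esum1 => -[i j] _ /=.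
have [->|i0] := eqVneq (phi i) 0%R; first by rewrite mul0r mul0e.
have [->|j0] := eqVneq (phi j) 0%R; first by rewrite mulr0 mul0e.
have /andP[xi xiC] := xC i0; have /andP[xj xjC] := xC j0.
rewrite diracE memNset ?mule0// => /=; apply.
by rewrite /= in_itv/= mulr_ge0//= expr2 ler_pM.
Qed.

Lemma atomic_square_moment n :
  measure_moment (atomic_square x phi_ge0) n =
  \sum_(i <oo) \sum_(j <oo) (a n i * a n j)%:E.
Proof.
have mD : measurable (`[0%R, +oo[ : set (measurableTypeR R)).
  exact: measurable_itv.
have mf : measurable_fun (`[0%R, +oo[ : set (measurableTypeR R))
    (fun t : measurableTypeR R => (t ^+ n)%:E).
  by apply/measurable_EFinP; exact: exprn_measurable.
have f0 (t : measurableTypeR R) : `[0%R, +oo[%classic t -> 0 <= (t ^+ n)%:E.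
  by move=> /=; rewrite in_itv/= andbT lee_fin => t0; rewrite exprn_ge0.
rewrite /measure_moment ge0_integral_measure_series//.
apply: eq_eseriesr => i _; rewrite ge0_integral_measure_series//.
apply: eq_eseriesr => j _; rewrite ge0_integral_mscale//= integral_dirac//.
have [i0|i0] := eqVneq (phi i) 0%R; first by rewrite /a i0 !mul0r mul0e.
have [j0|j0] := eqVneq (phi j) 0%R; first by rewrite /a j0 mul0r !mulr0 mul0e.
have /andP[xi _] := xC i0; have /andP[xj _] := xC j0.
rewrite diracE mem_set ?mul1e/= ?in_itv/= ?andbT ?mulr_ge0//.
by rewrite -EFinM /a exprMn mulrACA.
Qed.

Lemma atomic_moment (nu : borel_measure R) n :
  (forall A : set (measurableTypeR R), measurable A ->
    nu A = \sum_(0 <= i <oo) (phi i)%:E * \d_(x i) A) ->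
  measure_moment nu n = \sum_(i <oo) (a n i)%:E.
Proof.
move=> nuE.
have mD : measurable (`[0%R, +oo[ : set (measurableTypeR R)).
  exact: measurable_itv.
have mf : measurable_fun (`[0%R, +oo[ : set (measurableTypeR R))
    (fun t : measurableTypeR R => (t ^+ n)%:E).
  by apply/measurable_EFinP; exact: exprn_measurable.
have f0 (t : measurableTypeR R) : `[0%R, +oo[%classic t -> 0 <= (t ^+ n)%:E.
  by move=> /=; rewrite in_itv/= andbT lee_fin => t0; rewrite exprn_ge0.
(* [nu] is traded for an explicit series of scaled Dirac masses, agreeing with it on measurable
   sets, so that the integral can be taken term by term. *)
rewrite /measure_moment (@eq_measure_integral _ _ _ _ (mseries (fun i =>
    mscale (NngNum (phi_ge0 i)) (@dirac _ (measurableTypeR R) (x i) R)) 0));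
  last first.
  by move=> A mA _; rewrite nuE.
rewrite ge0_integral_measure_series//.
apply: eq_eseriesr => i _; rewrite ge0_integral_mscale//= integral_dirac//.
have [i0|/xC/andP[xi _]] := eqVneq (phi i) 0%R.
  by rewrite /a i0 !mul0r mul0e.
by rewrite diracE mem_set ?mul1e/= ?in_itv/= ?andbT.
Qed.

(** The double series of products [a n i * a n j] factors into the square of the single series. The
    constant pulled out of a series has to be real, hence the finiteness of the moment and the
    passage through [fine S]. *)
Lemma atomic_square_momentE (nu : borel_measure R) n :
  (forall A : set (measurableTypeR R), measurable A ->
    nu A = \sum_(0 <= i <oo) (phi i)%:E * \d_(x i) A) ->
  measure_moment nu n < +oo ->
  measure_moment (atomic_square x phi_ge0) n = measure_moment nu n ^+ 2.
Proof.
move=> nuE; rewrite (atomic_moment _ nuE) atomic_square_moment => fin.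
have a0 i : 0 <= (a n i)%:E by rewrite lee_fin.
set S := \sum_(i <oo) (a n i)%:E in fin *.
have S0 : 0 <= S by apply: nneseries_ge0.
have SE : (fine S)%:E = S by rewrite fineK// ge0_fin_numE.
transitivity (\sum_(i <oo) (fine S)%:E * (a n i)%:E).
  apply: eq_eseriesr => i _.
  under eq_eseriesr do rewrite EFinM.
  by rewrite nneseriesZl// SE muleC.
by rewrite nneseriesZl// SE expe2.
Qed.

End atomic_square_moments.

(** * Existence of the square and the formula for it *)

Theorem proposition2p3 (R : realType)
  (nu : probability (measurableTypeR R) R)
  (phi x : nat -> R)
  (phi_ge0 : forall i : nat, (0 <= phi i)%R)
  (nuE : forall A : set (measurableTypeR R), measurable A ->
    nu A = \sum_(0 <= i <oo) (phi i)%:E * \d_(x i) A)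
  (nu_supp : compactly_supported_ge0 nu) :
  let X : set R := range x in
  let X2 : set R := [set (s * t)%R | s in X & t in X] in
  (exists mu : {measure set (measurableTypeR R) -> \bar R},
     is_measure_square nu mu) /\
  (forall mu : {measure set (measurableTypeR R) -> \bar R},
     is_measure_square nu mu ->
     forall A : set (measurableTypeR R), measurable A ->
       mu A =
       \esum_(z in X2)
         ((\esum_(ij in [set ij : nat * nat | (x ij.1 * x ij.2)%R = z])
             (phi ij.1 * phi ij.2)%:E)
          * \d_z A)).
Proof.
move=> X X2.
have [C0 /(_ _ (lexx C0)) nuC] := compactly_supported_ge0_itv nu_supp.
have mC : measurable (`[0%R, C0] : set (measurableTypeR R)).
  exact: measurable_itv.
have xC i : phi i != 0%R -> (0 <= x i <= C0)%R.
  move=> phii; suff /(atoms_in_support phi_ge0)/(_ _ phii) :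
    \sum_(i <oo) (phi i)%:E * \d_(x i) (~` `[0%R, C0]) = 0.
    by rewrite /= in_itv.
  by rewrite -nuE//; exact: measurableC.
have nuCoo : nu `[0%R, C0]%classic < +oo.
  by rewrite (le_lt_trans (probability_le1 nu mC)) ?ltry.
pose mu0 := atomic_square x phi_ge0.
have mom_fin n : measure_moment nu n < +oo.
  have := integrable_lty mC (integrable_horner 'X^n nuCoo).
  rewrite (measure_moment_itv _ nuC); congr (_ < _).
  by apply: eq_integral => t _ /=; rewrite hornerXn.
have sq0 : is_measure_square nu mu0.
  split; first exact: compactly_supported_atomic_square xC.
  by move=> n; exact: (atomic_square_momentE phi_ge0 xC nuE).
split; first by exists mu0.
move=> mu [mu_supp mu_mom] A mA.
rewrite -(atomic_square_fibers x phi_ge0).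
have [mu0_supp mu0_mom] := sq0.
(* The mass of [mu] is its moment of order 0, which equals [nu setT ^+ 2 = 1]. *)
have muT : mu setT < +oo.
  rewrite -measure_moment0// mu_mom measure_moment0//.
  by rewrite [X in X ^+ 2](probability_setT nu) expe2 mule1 ltry.
apply: (@eq_measure_atomic _ _ _ X2) => //.
- exact: countable_range2.
(* In the grouped form every atom is a point of [X2], so the complement receives no mass. *)
- rewrite atomic_square_fibers; apply: esum1 => z Xz.
  by rewrite diracE memNset ?mule0// => /=; apply.
- by rewrite -!measure_moment0// mu_mom mu0_mom.
- by move=> z; apply: moments_point_mass => // n; rewrite mu_mom mu0_mom.
Qed.
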